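(* Let $\mathcal{U}=\{u_1,\dots,u_N\}$ be a weighted SVD basis of $\mathcal{N}_\Phi(X)$ with singular values $\sigma_1^2,\dots,\sigma_N^2$, let $f\in\mathcal{N}_\Phi(\Omega)$ and let $M\in\mathbb{N}$, $M\le N$. Then the weighted least-squares approximant $\Lambda_M[f]$ of order $M$ of $f$, i.e. the minimizer of $\|f-g\|_{\ell_2^w(X)}$ over $g\in\mathrm{span}\{u_1,\dots,u_M\}$, is given by $$\Lambda_M[f](x)=\sum_{j=1}^M\frac{(f,u_j)_{\ell_2^w(X)}}{\sigma_j^2}\,u_j(x)=\sum_{j=1}^M (f,u_j)_\Phi\,u_j(x)\qquad\forall x\in\Omega,$$ and hence $\Lambda_M[f]$ is the truncation to the first $M$ terms of the interpolant $P_X[f]=\sum_{j=1}^N (f,u_j)_\Phi\,u_j$.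
   Context: Let $\Omega\subset\mathbb{R}^n$ be a bounded measurable set with Lebesgue measure $|\Omega|$, and let $\Phi:\Omega\times\Omega\to\mathbb{R}$ be a continuous, symmetric, radial kernel, $\Phi(x,y)=\phi(\|x-y\|_2)$ with $\phi:[0,\infty)\to\mathbb{R}$, that is (strictly) positive definite: for all finite sets of pairwise distinct points the matrix of kernel values is positive definite. The native space $\mathcal{N}_\Phi(\Omega)$ is the real Hilbert space of functions on $\Omega$ with reproducing kernel $\Phi$, with inner product $(\cdot,\cdot)_\Phi$ and norm $\|\cdot\|_\Phi$. For a set $X=\{x_1,\dots,x_N\}\subset\Omega$ of pairwise distinct points, $\mathcal{N}_\Phi(X)=\mathrm{span}\{\Phi(\cdot,x_1),\dots,\Phi(\cdot,x_N)\}$ and $A=(\Phi(x_i,x_j))_{1\le i,j\le N}$. Let $\mathcal{W}=\{w_1,\dots,w_N\}$ be positive weights of a cubature rule $(X,\mathcal{W})_N$ on $\Omega$, assumed exact on constants, i.e. $\sum_{j=1}^N w_j=|\Omega|$. Put $W=\mathrm{diag}(w_1,\dots,w_N)$ and $(f,g)_{\ell_2^w(X)}=\sum_{i=1}^N w_i f(x_i)g(x_i)$, with $\|f\|_{\ell_2^w(X)}^2=(f,f)_{\ell_2^w(X)}$. Weighted SVD basis: let $\sqrt{W}\,A\,\sqrt{W}=Q\,\Sigma^2\,Q^T$ be a singular value decomposition (equivalently, an orthogonal diagonalization), with $Q$ orthogonal and $\Sigma=\mathrm{diag}(\sigma_1,\dots,\sigma_N)$, $\sigma_1\ge\dots\ge\sigma_N>0$.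 The associated weighted SVD basis $\mathcal{U}=\{u_1,\dots,u_N\}$ of $\mathcal{N}_\Phi(X)$ is given by $u_j=\sum_{i=1}^N (C_{\mathcal U})_{ij}\,\Phi(\cdot,x_i)$ with $C_{\mathcal U}=\sqrt{W}\,Q\,\Sigma^{-1}$; equivalently $(u_j(x_i))_{i,j}=\sqrt{W^{-1}}\,Q\,\Sigma$. For $f\in\mathcal{N}_\Phi(\Omega)$, $P_X[f]$ denotes the unique element of $\mathcal{N}_\Phi(X)$ with $P_X[f](x_i)=f(x_i)$ for $i=1,\dots,N$. *)

(* Defs.v *)
From mathcomp Require Import all_boot all_order all_algebra.
From mathcomp Require Import all_classical all_reals all_analysis.

Set Implicit Arguments.
Unset Strict Implicit.
Unset Printing Implicit Defensive.

Import Order.TTheory GRing.Theory Num.Theory.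
Import numFieldNormedType.Exports.

Local Open Scope classical_set_scope.
Local Open Scope ring_scope.

(* The norm `|v| of 'rV[R]_n in the library is the maximum norm. *)
Definition norm2 (R : realType) (n : nat) (v : 'rV[R]_n) : R :=
  Num.sqrt (\sum_(i < n) v 0 i ^+ 2).

Definition box (R : realType) (n : nat) (a b : 'rV[R]_n) : set 'rV[R]_n :=
  [set v | forall i, a 0 i <= v 0 i <= b 0 i].

Definition box_volume (R : realType) (n : nat) (a b : 'rV[R]_n) : R :=
  \prod_(i < n) Num.max 0 (b 0 i - a 0 i).

(* n-dimensional Lebesgue outer measure. The covers are countable families of
   boxes indexed by a subset P of nat, so that finite and empty covers are
   allowed; this is only needed for n = 0, where every box has volume 1. *)
Definition lebesgue_outer (R : realType) (n : nat) (A : set 'rV[R]_n) : \bar R :=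
  ereal_inf [set s | exists (P : pred nat) (a b : nat -> 'rV[R]_n),
    A `<=` \bigcup_(k in [set k | P k]) box (a k) (b k) /\
    s = (\sum_(k <oo | P k) (box_volume (a k) (b k))%:E)%E].

(* Lebesgue measurability is Caratheodory's condition; on measurable sets the
   Lebesgue measure is lebesgue_outer. *)
Definition lebesgue_measurable (R : realType) (n : nat) (A : set 'rV[R]_n) : Prop :=
  (@lebesgue_outer R n).-caratheodory A.

Definition posdefmx (R : realType) (m : nat) (K : 'M[R]_m) : Prop :=
  K^T = K /\ forall c : 'cV[R]_m, c != 0 -> 0 < (c^T *m K *m c) 0 0.

Definition kernel_matrix (R : realType) (T : Type) (Phi : T -> T -> R)
    (m : nat) (x : 'I_m -> T) : 'M[R]_m :=
  \matrix_(i < m, j < m) Phi (x i) (x j).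

(* Omega is used as a type, with its subspace topology. Only the values of phi
   on [0, +oo[ matter. *)
Record radial_posdef_kernel (R : realType) (n : nat) (Omega : set 'rV[R]_n)
    (phi : R -> R) (Phi : Omega -> Omega -> R) : Prop := RadialPosdefKernel {
  kernel_continuous : continuous (fun p : Omega * Omega => Phi p.1 p.2);
  kernel_symmetric : forall y z, Phi y z = Phi z y;
  kernel_radial : forall y z, Phi y z = phi (norm2 (val y - val z));
  kernel_posdef : forall (m : nat) (y : 'I_m -> Omega), injective y ->
    posdefmx (kernel_matrix Phi y) }.

(* H, with the inner product ip, is the real Hilbert space of functions on T
   with reproducing kernel Phi. The values of ip outside H are irrelevant. *)
Record native_space (R : realType) (T : Type) (Phi : T -> T -> R)
    (H : set (T -> R)) (ip : (T -> R) -> (T -> R) -> R) : Prop := NativeSpace {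
  native0 : H (fun=> 0);
  native_lin : forall (a : R) f g, H f -> H g -> H (fun y => a * f y + g y);
  native_ip_lin : forall (a : R) f g h, H f -> H g -> H h ->
    ip (fun y => a * f y + g y) h = a * ip f h + ip g h;
  native_ip_sym : forall f g, H f -> H g -> ip f g = ip g f;
  native_ip_ge0 : forall f, H f -> 0 <= ip f f;
  native_ip_eq0 : forall f, H f -> ip f f = 0 -> forall y, f y = 0;
  native_complete : forall s : nat -> T -> R, (forall k, H (s k)) ->
    (forall e : R, 0 < e -> exists K, forall k l, (K <= k)%N -> (K <= l)%N ->
      Num.sqrt (ip (fun y => s k y - s l y) (fun y => s k y - s l y)) < e) ->
    exists2 f, H f &
      (fun k => Num.sqrt (ip (fun y => s k y - f y) (fun y => s k y - f y)))
        @ \oo --> (0 : R);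
  native_kernel : forall z, H (fun y => Phi y z);
  native_reproducing : forall f z, H f -> f z = ip f (fun y => Phi y z) }.

(* Linear span of the g i such that P i. *)
Definition lin_span (R : realType) (T : Type) (m : nat) (P : pred 'I_m)
    (g : 'I_m -> T -> R) : set (T -> R) :=
  [set h | exists c : 'I_m -> R, forall y, h y = \sum_(i < m | P i) c i * g i y].

Definition native_span (R : realType) (T : Type) (Phi : T -> T -> R)
    (N : nat) (x : 'I_N -> T) : set (T -> R) :=
  lin_span xpredT (fun i y => Phi y (x i)).

Record cubature_weights (R : realType) (n : nat) (Omega : set 'rV[R]_n)
    (N : nat) (w : 'I_N -> R) : Prop := CubatureWeights {
  weights_gt0 : forall i, 0 < w i;
  weights_exact_const : (\sum_(i < N) w i)%:E = lebesgue_outer Omega }.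

Definition wl2_dot (R : realType) (T : Type) (N : nat) (x : 'I_N -> T)
    (w : 'I_N -> R) (f g : T -> R) : R :=
  \sum_(i < N) w i * f (x i) * g (x i).

Definition wl2_norm (R : realType) (T : Type) (N : nat) (x : 'I_N -> T)
    (w : 'I_N -> R) (f : T -> R) : R :=
  Num.sqrt (wl2_dot x w f f).

Definition diag_of (R : realType) (N : nat) (d : 'I_N -> R) : 'M[R]_N :=
  diag_mx (\row_(j < N) d j).

Record weighted_svd (R : realType) (N : nat) (A : 'M[R]_N) (w : 'I_N -> R)
    (Q : 'M[R]_N) (sigma : 'I_N -> R) : Prop := WeightedSvd {
  svd_orthogonal : Q^T *m Q = 1%:M;
  svd_sigma_gt0 : forall j, 0 < sigma j;
  svd_sigma_noninc : forall i j : 'I_N, (i <= j)%N -> sigma j <= sigma i;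
  svd_eq : let sqrtW := diag_of (fun i => Num.sqrt (w i)) in
    let Sigma := diag_of sigma in
    sqrtW *m A *m sqrtW = Q *m (Sigma *m Sigma) *m Q^T }.

(* u is the weighted SVD basis associated with some orthogonal Q; the singular
   values of sqrt(W) A sqrt(W) are the sigma j ^+ 2. *)
Definition weighted_svd_basis (R : realType) (T : Type) (Phi : T -> T -> R)
    (N : nat) (x : 'I_N -> T) (w sigma : 'I_N -> R) (u : 'I_N -> T -> R) : Prop :=
  exists2 Q : 'M[R]_N, weighted_svd (kernel_matrix Phi x) w Q sigma &
    let C := diag_of (fun i => Num.sqrt (w i)) *m Q *m invmx (diag_of sigma) in
    forall j y, u j y = \sum_(i < N) C i j * Phi y (x i).

(* With indices starting at 0, u_1, ..., u_M are the u j with j < M. *)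
Definition wls_approximant (R : realType) (T : Type) (N : nat) (x : 'I_N -> T)
    (w : 'I_N -> R) (u : 'I_N -> T -> R) (M : nat) (f L : T -> R) : Prop :=
  let V := lin_span [pred j : 'I_N | (j < M)%N] u in
  V L /\ forall g, V g ->
    wl2_norm x w (fun y => f y - L y) <= wl2_norm x w (fun y => f y - g y).

Definition interpolant (R : realType) (T : Type) (Phi : T -> T -> R)
    (N : nat) (x : 'I_N -> T) (f p : T -> R) : Prop :=
  native_span Phi x p /\ forall i, p (x i) = f (x i).

(* L is the truncation to its first M terms of an expansion of p in the family
   u; the expansion is unique when u is linearly independent. *)
Definition truncation (R : realType) (T : Type) (N : nat) (u : 'I_N -> T -> R)
    (M : nat) (p L : T -> R) : Prop :=
  exists c : 'I_N -> R,
    (forall y, p y = \sum_(j < N) c j * u j y) /\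
    (forall y, L y = \sum_(j < N | (j < M)%N) c j * u j y).

(* Main.v *)
(** With s_i = sqrt (w_i), the decomposition gives s_i u_j(x_i) = Q_ij sigma_j.
    Orthogonality of the columns of Q makes u orthogonal in l2^w(X), with
    squared norms sigma_j^2; orthogonality of its rows gives
    Phi(y, x_i) = sum_j u_j(x_i) u_j(y) on all of Omega.  Moreover
    u_j = sigma_j^-2 sum_i w_i u_j(x_i) Phi(., x_i), so the reproducing property
    turns (f, u_j)_Phi into sigma_j^-2 (f, u_j) in l2^w(X): least squares and
    interpolation thus share their Fourier coefficients. *)
Require Import Defs.
From mathcomp Require Import all_boot all_order all_algebra.
From mathcomp Require Import all_classical all_reals all_analysis.
From mathcomp Require Import ring.
Import Order.TTheory GRing.Theory Num.Theory.
Import numFieldNormedType.Exports.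
Set Implicit Arguments.
Unset Strict Implicit.
Unset Printing Implicit Defensive.
Local Open Scope classical_set_scope.
Local Open Scope ring_scope.

(** * Algebra of the weighted discrete inner product *)

Lemma wl2_dotC (R : realType) (T : Type) (N : nat) (x : 'I_N -> T)
    (w : 'I_N -> R) (f g : T -> R) :
  wl2_dot x w f g = wl2_dot x w g f.
Proof. by apply: eq_bigr => i _; rewrite mulrAC. Qed.

Lemma wl2_dot_ge0 (R : realType) (T : Type) (N : nat) (x : 'I_N -> T)
    (w : 'I_N -> R) (f : T -> R) :
  (forall i, 0 < w i) -> 0 <= wl2_dot x w f f.
Proof.
move=> w_gt0; apply: sumr_ge0 => i _.
by rewrite -mulrA -expr2 mulr_ge0 ?sqr_ge0 // ltW.
Qed.

Lemma eq_wl2_dotl (R : realType) (T : Type) (N : nat) (x : 'I_N -> T)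
    (w : 'I_N -> R) (f g h : T -> R) :
  (forall i, f (x i) = g (x i)) -> wl2_dot x w f h = wl2_dot x w g h.
Proof. by move=> fg; apply: eq_bigr => i _; rewrite fg. Qed.

Lemma wl2_dot_sumr (R : realType) (T : Type) (N m : nat) (x : 'I_N -> T)
    (w : 'I_N -> R) (f : T -> R) (P : pred 'I_m) (c : 'I_m -> R)
    (u : 'I_m -> T -> R) :
  wl2_dot x w f (fun y => \sum_(j < m | P j) c j * u j y) =
  \sum_(j < m | P j) c j * wl2_dot x w f (u j).
Proof.
rewrite /wl2_dot; under eq_bigr do rewrite mulr_sumr.
rewrite exchange_big; apply: eq_bigr => j _.
by rewrite mulr_sumr; apply: eq_bigr => i _; rewrite mulrCA.
Qed.

Lemma wl2_dotBB (R : realType) (T : Type) (N : nat) (x : 'I_N -> T)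
    (w : 'I_N -> R) (f g : T -> R) :
  wl2_dot x w (fun y => f y - g y) (fun y => f y - g y) =
  wl2_dot x w f f - wl2_dot x w f g *+ 2 + wl2_dot x w g g.
Proof.
rewrite /wl2_dot -sumrMnl -sumrB -big_split /=.
by apply: eq_bigr => i _; ring.
Qed.

(** * Least squares in an orthogonal family *)

Definition wl2_orthogonal (R : realType) (T : Type) (N m : nat) (x : 'I_N -> T)
    (w : 'I_N -> R) (u : 'I_m -> T -> R) (sigma : 'I_m -> R) : Prop :=
  forall j k, wl2_dot x w (u j) (u k) = (j == k)%:R * sigma j ^+ 2.

Lemma wl2_dot_orthogonal_sum (R : realType) (T : Type) (N m : nat)
    (x : 'I_N -> T) (w : 'I_N -> R) (u : 'I_m -> T -> R) (sigma : 'I_m -> R)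
    (P : pred 'I_m) (c : 'I_m -> R) (k : 'I_m) :
  wl2_orthogonal x w u sigma -> P k ->
  wl2_dot x w (fun y => \sum_(j < m | P j) c j * u j y) (u k) =
  c k * sigma k ^+ 2.
Proof.
move=> ou Pk; rewrite wl2_dotC wl2_dot_sumr (bigD1 k) //= ou eqxx mul1r.
rewrite big1 ?addr0 // => j /andP[_ jk].
by rewrite ou eq_sym (negPf jk) mul0r mulr0.
Qed.

(** Orthogonality removes the cross terms, leaving for each j the quadratic sigma_j^2 d_j^2 - 2 d_j
    (f, u_j); completing the square centres it at the Fourier coefficient c_j. Only the last sum
    depends on d, and it vanishes when d = c on P. *)
Lemma wl2_residual (R : realType) (T : Type) (N m : nat)
    (x : 'I_N -> T) (w : 'I_N -> R) (u : 'I_m -> T -> R) (sigma : 'I_m -> R)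
    (P : pred 'I_m) (d : 'I_m -> R) (f : T -> R)
    (c := fun j => wl2_dot x w f (u j) / sigma j ^+ 2)
    (g := fun y => \sum_(j < m | P j) d j * u j y) :
  wl2_orthogonal x w u sigma -> (forall j, 0 < sigma j) ->
  wl2_dot x w (fun y => f y - g y) (fun y => f y - g y) =
  wl2_dot x w f f - \sum_(j < m | P j) sigma j ^+ 2 * c j ^+ 2 +
  \sum_(j < m | P j) sigma j ^+ 2 * (d j - c j) ^+ 2.
Proof.
move=> ou s_gt0; rewrite wl2_dotBB !wl2_dot_sumr.
rewrite [in X in _ + X](eq_bigr (fun j => d j ^+ 2 * sigma j ^+ 2)); last first.
  by move=> k Pk; rewrite (wl2_dot_orthogonal_sum _ ou Pk) mulrA -expr2.
rewrite -!addrA; congr (_ + _); rewrite -sumrMnl -!sumrN -!big_split /=.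
apply: eq_bigr => j _.
have -> : wl2_dot x w f (u j) = c j * sigma j ^+ 2.
  by rewrite /c divfK // expf_neq0 // gt_eqF.
ring.
Qed.

Lemma orthogonal_wls_approximant (R : realType) (T : Type) (N : nat)
    (x : 'I_N -> T) (w : 'I_N -> R) (u : 'I_N -> T -> R) (sigma : 'I_N -> R)
    (M : nat) (f L : T -> R) :
  (forall i, 0 < w i) -> (forall j, 0 < sigma j) ->
  wl2_orthogonal x w u sigma ->
  wls_approximant x w u M f L <->
  forall y, L y =
    \sum_(j < N | (j < M)%N) wl2_dot x w f (u j) / sigma j ^+ 2 * u j y.
Proof.
move=> w_gt0 s_gt0 ou; set c := fun j => wl2_dot x w f (u j) / sigma j ^+ 2.
have dist_ge0 (d : 'I_N -> R) j : 0 <= sigma j ^+ 2 * (d j - c j) ^+ 2.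
  by rewrite mulr_ge0 ?sqr_ge0.
have residual d := wl2_residual [pred j : 'I_N | (j < M)%N] d f ou s_gt0.
split=> [[[d /funext ->] minL] y|/funext ->].
  (* The Fourier sum is the competitor to test minimality against: its own residual has no last sum,
     so that of L is at most 0. *)
  have cV : lin_span [pred j : 'I_N | (j < M)%N] u
      (fun y => \sum_(j < N | (j < M)%N) c j * u j y) by exists c.
  have := minL _ cV.
  rewrite /wl2_norm ler_psqrt ?nnegrE ?wl2_dot_ge0 // !residual lerD2l.
  under [leRHS]eq_bigr do rewrite subrr expr0n mulr0.
  rewrite big1_eq => sum_le0; apply: eq_bigr => j jM; congr (_ * _).
  (* A sum of nonnegative terms that is at most 0 has all terms 0, and sigma_j > 0 then forces d_j =
     c_j for j < M. *)
  have /eqP/psumr_eq0P : \sum_(j < N | (j < M)%N)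
      sigma j ^+ 2 * (d j - c j) ^+ 2 == 0.
    by rewrite eq_le sum_le0 sumr_ge0.
  move=> /(_ (fun j _ => dist_ge0 d j)) /(_ j jM) /eqP.
  by rewrite mulf_eq0 !expf_eq0 /= gt_eqF //= subr_eq0 => /eqP.
split=> [|g [d /funext ->]]; first by exists c.
rewrite /wl2_norm ler_psqrt ?nnegrE ?wl2_dot_ge0 // !residual lerD2l.
under eq_bigr do rewrite subrr expr0n mulr0.
by rewrite big1_eq sumr_ge0.
Qed.

(** * Finite linear combinations in the native space *)

Lemma native_ip_suml (R : realType) (T : Type) (Phi : T -> T -> R)
    (H : set (T -> R)) (ip : (T -> R) -> (T -> R) -> R) (m : nat)
    (c : 'I_m -> R) (g : 'I_m -> T -> R) (h : T -> R) :
  native_space Phi H ip -> (forall i, H (g i)) -> H h ->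
  H (fun y => \sum_(i < m) c i * g i y) /\
  ip (fun y => \sum_(i < m) c i * g i y) h = \sum_(i < m) c i * ip (g i) h.
Proof.
(* The enumeration of indices is generalized to an arbitrary list. Membership and formula go through
   one induction, since linearity at the head requires the tail to lie in [H]. *)
move=> nH Hg Hh; rewrite /index_enum; elim: (locked_with _ _) => [|i r [Hr ipr]].
  have -> : (fun y => \sum_(i <- [::]) c i * g i y) = fun=> 0.
    by apply/funext => y; rewrite big_nil.
  split; first exact: native0 nH.
  (* Linearity at 1 * 0 + 0 gives ip 0 h = ip 0 h + ip 0 h, hence ip 0 h = 0. *)
  have := native_ip_lin nH 1 (native0 nH) (native0 nH) Hh.
  under [X in ip X h]eq_fun do rewrite mulr0 addr0.
  by rewrite mul1r big_nil => /eqP; rewrite -subr_eq subrr eq_sym => /eqP.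
under eq_fun do rewrite big_cons.
rewrite big_cons -ipr; split; first exact: (native_lin nH (c i) (Hg i) Hr).
exact: (native_ip_lin nH (c i) (Hg i) Hr Hh).
Qed.

(** * The weighted SVD basis: nodal values, orthogonality, span, interpolation *)

Lemma diag_of_unit (R : realType) (N : nat) (d : 'I_N -> R) :
  (forall j, 0 < d j) -> diag_of d \in unitmx.
Proof.
move=> d_gt0; rewrite unitmxE det_diag unitfE prodf_seq_neq0.
by apply/allP => j _ /=; rewrite mxE gt_eqF.
Qed.

(** Trades the matrix definition of the basis for entrywise identities, in which the coefficients of
    u_j are expressed by its own nodal values. *)
Lemma svd_basis_nodes (R : realType) (T : Type) (Phi : T -> T -> R) (N : nat)
    (x : 'I_N -> T) (w sigma : 'I_N -> R) (u : 'I_N -> T -> R) :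
  (forall i, 0 < w i) -> weighted_svd_basis Phi x w sigma u ->
  exists Q : 'M[R]_N, [/\ Q^T *m Q = 1%:M, forall j, 0 < sigma j,
    forall i j, Num.sqrt (w i) * u j (x i) = Q i j * sigma j &
    forall j y, u j y =
      \sum_(i < N) w i * u j (x i) / sigma j ^+ 2 * Phi y (x i)].
Proof.
move=> w_gt0 [Q [QTQ s_gt0 _ svdE] uE]; exists Q.
set C := (_ *m invmx _) in uE.
have S_unit := diag_of_unit s_gt0.
have uQ i j : Num.sqrt (w i) * u j (x i) = Q i j * sigma j.
  (* Since Q^T Q = 1, the decomposition gives sqrt(W) A sqrt(W) Q = Q Sigma^2, and the inverse in
     [C] cancels one factor Sigma. *)
  have : diag_of (fun i => Num.sqrt (w i)) *m (kernel_matrix Phi x *m C) =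
      Q *m diag_of sigma.
    rewrite /C !mulmxA svdE -!mulmxA (mulmxA Q^T) QTQ mul1mx.
    by rewrite mulmxV // mulmx1.
  move=> /matrixP/(_ i j); rewrite mul_diag_mx mul_mx_diag !mxE => <-.
  rewrite uE; congr (_ * _); apply: eq_bigr => k _.
  by rewrite [kernel_matrix _ _ _ _]mxE mulrC.
have CS : C *m diag_of sigma = diag_of (fun i => Num.sqrt (w i)) *m Q.
  by rewrite mulmxKV.
clearbody C; split=> // j y; rewrite uE; apply: eq_bigr => i _; congr (_ * _).
move/matrixP: CS => /(_ i j); rewrite mul_diag_mx mul_mx_diag !mxE => CE.
have s_neq0 : sigma j != 0 by rewrite gt_eqF.
(* One factor sigma_j turns C_ij into s_i Q_ij; the second turns Q_ij sigma_j into s_i u_j(x_i), and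
   s_i^2 = w_i. *)
apply: (mulIf s_neq0); apply: (mulIf s_neq0).
rewrite CE -[LHS]mulrA -uQ mulrA -expr2 sqr_sqrtr ?ltW //.
by rewrite -[RHS]mulrA -expr2 divfK // expf_neq0.
Qed.

Lemma svd_basis_orthogonal (R : realType) (T : Type) (Phi : T -> T -> R)
    (N : nat) (x : 'I_N -> T) (w sigma : 'I_N -> R) (u : 'I_N -> T -> R) :
  (forall i, 0 < w i) -> weighted_svd_basis Phi x w sigma u ->
  wl2_orthogonal x w u sigma.
Proof.
move=> w_gt0 /(svd_basis_nodes w_gt0)[Q [QTQ _ uQ _]] j k.
(* Each weight w_i = s_i^2 is shared between the two nodal values. *)
transitivity ((Q^T *m Q) j k * (sigma j * sigma k)).
  rewrite mxE mulr_suml; apply: eq_bigr => i _.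
  rewrite -[w i]sqr_sqrtr ?ltW // mxE mulrACA -!uQ; ring.
by rewrite QTQ mxE; case: eqP => [->|_]; rewrite ?expr2 // !mul0r.
Qed.

(* The dual orthogonality relation, from the rows of Q: it inverts the nodal
   matrix of u. *)
Lemma svd_basis_dual (R : realType) (T : Type) (Phi : T -> T -> R) (N : nat)
    (x : 'I_N -> T) (w sigma : 'I_N -> R) (u : 'I_N -> T -> R) (i k : 'I_N) :
  (forall i, 0 < w i) -> weighted_svd_basis Phi x w sigma u ->
  \sum_(j < N) w k * u j (x k) / sigma j ^+ 2 * u j (x i) = (k == i)%:R.
Proof.
move=> w_gt0 /(svd_basis_nodes w_gt0)[Q [QTQ s_gt0 uQ _]].
have sqrt_neq0 l : Num.sqrt (w l) != 0 by rewrite gt_eqF // sqrtr_gt0.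
have uE l j : u j (x l) = Q l j * sigma j / Num.sqrt (w l).
  by rewrite -uQ mulrAC divff // mul1r.
transitivity ((Q *m Q^T) k i * Num.sqrt (w k) / Num.sqrt (w i)).
  rewrite mxE !mulr_suml; apply: eq_bigr => j _.
  have s_neq0 : sigma j != 0 by rewrite gt_eqF.
  rewrite -[w k in LHS]sqr_sqrtr ?ltW // !uE mxE; field.
  by rewrite s_neq0 !sqrt_neq0.
(* A left inverse of a square matrix is also a right inverse, so Q Q^T = 1. *)
rewrite (mulmx1C QTQ) mxE; case: eqP => [->|_]; last by rewrite !mul0r.
by rewrite mul1r divff.
Qed.

(** Expand u_j(y) in the translates Phi(y, x_k) and sum over j first: the dual relation leaves only
    k = i. Nothing ties y to the nodes. *)
Lemma svd_basis_kernel (R : realType) (T : Type) (Phi : T -> T -> R) (N : nat)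
    (x : 'I_N -> T) (w sigma : 'I_N -> R) (u : 'I_N -> T -> R) (i : 'I_N)
    (y : T) :
  (forall i, 0 < w i) -> weighted_svd_basis Phi x w sigma u ->
  Phi y (x i) = \sum_(j < N) u j (x i) * u j y.
Proof.
move=> w_gt0 u_svd; have [Q [_ _ _ uE]] := svd_basis_nodes w_gt0 u_svd.
under eq_bigr => j _ do rewrite [u j y]uE mulr_sumr.
rewrite exchange_big /=.
transitivity (\sum_(k < N) (k == i)%:R * Phi y (x k)).
  rewrite (bigD1 i) //= eqxx mul1r big1 ?addr0 // => k /negPf ->.
  by rewrite mul0r.
apply: eq_bigr => k _; rewrite -(svd_basis_dual i k w_gt0 u_svd) mulr_suml.
by apply: eq_bigr => j _; rewrite mulrA [_ * u j (x i)]mulrC.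
Qed.

Lemma svd_basis_span (R : realType) (T : Type) (Phi : T -> T -> R) (N : nat)
    (x : 'I_N -> T) (w sigma : 'I_N -> R) (u : 'I_N -> T -> R) (p : T -> R) :
  (forall i, 0 < w i) -> weighted_svd_basis Phi x w sigma u ->
  native_span Phi x p <-> lin_span xpredT u p.
Proof.
move=> w_gt0 u_svd; have [Q [_ _ _ uE]] := svd_basis_nodes w_gt0 u_svd.
split=> -[c pE].
  exists (fun j => \sum_(i < N) c i * u j (x i)) => y; rewrite pE.
  under [RHS]eq_bigr do rewrite mulr_suml.
  rewrite exchange_big; apply: eq_bigr => i _ /=.
  rewrite (svd_basis_kernel i y w_gt0 u_svd) mulr_sumr.
  by apply: eq_bigr => j _; rewrite mulrA.
exists (fun i => \sum_(j < N) c j * (w i * u j (x i) / sigma j ^+ 2)) => y.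
rewrite pE; under [RHS]eq_bigr do rewrite mulr_suml.
rewrite exchange_big; apply: eq_bigr => j _ /=.
rewrite uE mulr_sumr.
by apply: eq_bigr => i _; rewrite mulrA.
Qed.

(** The discrete product sees only nodal values, where p agrees with f, so pairing p with u_k reads
    off its coefficients. Conversely, at x_i the dual relation collapses the Fourier sum to f(x_i).
    Existence and uniqueness of the interpolant both follow. *)
Lemma svd_basis_interpolant (R : realType) (T : Type) (Phi : T -> T -> R)
    (N : nat) (x : 'I_N -> T) (w sigma : 'I_N -> R) (u : 'I_N -> T -> R)
    (f p : T -> R) :
  (forall i, 0 < w i) -> weighted_svd_basis Phi x w sigma u ->
  interpolant Phi x f p <->
  forall y, p y = \sum_(j < N) wl2_dot x w f (u j) / sigma j ^+ 2 * u j y.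
Proof.
move=> w_gt0 u_svd; have [Q [_ s_gt0 _ _]] := svd_basis_nodes w_gt0 u_svd.
have ou := svd_basis_orthogonal w_gt0 u_svd.
split=> [[/(svd_basis_span _ w_gt0 u_svd)[c pE] pf] y|pE].
  rewrite pE; apply: eq_bigr => j _; congr (_ * _).
  rewrite -(eq_wl2_dotl w (u j) pf) (funext pE).
  rewrite (wl2_dot_orthogonal_sum (P := xpredT) _ ou) // mulfK //.
  by rewrite expf_neq0 // gt_eqF.
split=> [|i].
  apply/(svd_basis_span _ w_gt0 u_svd).
  by exists (fun j => wl2_dot x w f (u j) / sigma j ^+ 2).
rewrite pE; under eq_bigr do rewrite !mulr_suml.
rewrite exchange_big /=.
transitivity (\sum_(k < N) f (x k) * (k == i)%:R).
  apply: eq_bigr => k _; rewrite -(svd_basis_dual i k w_gt0 u_svd) mulr_sumr.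
  by apply: eq_bigr => j _; rewrite !mulrA [f _ * _]mulrC.
rewrite (bigD1 i) //= eqxx mulr1 big1 ?addr0 // => k /negPf ->.
by rewrite mulr0.
Qed.

(** * Native-space coefficients and the conclusion *)

Lemma svd_basis_native_dot (R : realType) (T : Type) (Phi : T -> T -> R)
    (H : set (T -> R)) (ip : (T -> R) -> (T -> R) -> R) (N : nat)
    (x : 'I_N -> T) (w sigma : 'I_N -> R) (u : 'I_N -> T -> R) (f : T -> R)
    (j : 'I_N) :
  native_space Phi H ip -> (forall i, 0 < w i) ->
  weighted_svd_basis Phi x w sigma u -> H f ->
  ip f (u j) = wl2_dot x w f (u j) / sigma j ^+ 2.
Proof.
move=> nH w_gt0 /(svd_basis_nodes w_gt0)[Q [_ _ _ uE]] Hf.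
have [Hu ipu] := native_ip_suml (fun i => w i * u j (x i) / sigma j ^+ 2) nH
  (fun i => native_kernel nH (x i)) Hf.
rewrite -(funext (uE j)) in Hu ipu.
(* Symmetry is used twice: to expand u_j in the left argument, then to return each kernel translate
   to the right, where it reproduces f(x_i). *)
rewrite (native_ip_sym nH) // ipu mulr_suml; apply: eq_bigr => i _.
rewrite (native_ip_sym nH) //; last exact: native_kernel nH _.
by rewrite -(native_reproducing nH) // mulrAC [w i * _ * _]mulrAC.
Qed.

Theorem proposition3p6 (R : realType) (n : nat) (Omega : set 'rV[R]_n)
  (Omega_bounded : bounded_set Omega)
  (Omega_measurable : lebesgue_measurable Omega)
  (phi : R -> R) (Phi : Omega -> Omega -> R)
  (Phi_kernel : radial_posdef_kernel phi Phi)
  (H : set (Omega -> R)) (ip : (Omega -> R) -> (Omega -> R) -> R)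
  (H_native : native_space Phi H ip)
  (N : nat) (x : 'I_N -> Omega) (x_inj : injective x)
  (w : 'I_N -> R) (w_cubature : cubature_weights Omega w)
  (sigma : 'I_N -> R) (u : 'I_N -> Omega -> R)
  (u_svd : weighted_svd_basis Phi x w sigma u)
  (f : Omega -> R) (f_native : H f)
  (M : nat) (M_le_N : (M <= N)%N) :
  [/\ forall L : Omega -> R, wls_approximant x w u M f L <->
        forall y, L y =
          \sum_(j < N | (j < M)%N) wl2_dot x w f (u j) / sigma j ^+ 2 * u j y,
      forall y,
        \sum_(j < N | (j < M)%N) wl2_dot x w f (u j) / sigma j ^+ 2 * u j y =
        \sum_(j < N | (j < M)%N) ip f (u j) * u j y,
      forall p : Omega -> R, interpolant Phi x f p <->
        forall y, p y = \sum_(j < N) ip f (u j) * u j y &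
      forall L p : Omega -> R, wls_approximant x w u M f L ->
        interpolant Phi x f p -> truncation u M p L].
Proof.
have w_gt0 := weights_gt0 w_cubature.
have [_ [_ s_gt0 _ _]] := svd_basis_nodes w_gt0 u_svd.
have ou := svd_basis_orthogonal w_gt0 u_svd.
have ipE j := svd_basis_native_dot j H_native w_gt0 u_svd f_native.
have wlsP L := orthogonal_wls_approximant M f L w_gt0 s_gt0 ou.
have intP p : interpolant Phi x f p <->
    forall y, p y = \sum_(j < N) ip f (u j) * u j y.
  by under eq_forall do under eq_bigr do rewrite ipE;
     exact: svd_basis_interpolant.
split=> // [y|L p /wlsP LE /intP pE]; first by under [RHS]eq_bigr do rewrite ipE.
(* The same native-space coefficients expand p in full and L up to order M. *)
exists (fun j => ip f (u j)); split=> // y.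
by rewrite LE; under [RHS]eq_bigr do rewrite ipE.
Qed.
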